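(* Let $A\subseteq\mathbb{Q}$ and let $\alpha\in\omega^\omega$ be an enumeration of $A$. If $$\forall\gamma\in\omega^\omega\;\exists n\Big[\forall i\le n+1[\alpha(\gamma(i))>0]\rightarrow q_{\alpha(\gamma(n))-1}\le q_{\alpha(\gamma(n+1))-1}\Big],$$ then $A\in\mathcal{WO}$.
   Context: Setting: intuitionistic mathematics (intuitionistic logic), assuming the axioms of countable choice and Brouwer's Bar Theorem, in the forms: (a) if $B\subseteq\omega$ is a bar in $\omega^\omega$ (i.e. $\forall\gamma\exists n[\overline{\gamma}n\in B]$), there is a stump $S$ such that $S\cap B$ is a bar in $\omega^\omega$; (b) Bar Induction: if $B,C\subseteq\omega$, $B$ is a bar in $\omega^\omega$, $B\subseteq C$ and $\forall s[s\in C\leftrightarrow\forall n[s\ast\langle n\rangle\in C]]$, then $\langle\,\rangle\in C$. (Finite sequences are coded by natural numbers, $\overline{\gamma}n=\langle\gamma(0),\dots,\gamma(n-1)\rangle$; stumps are the least class of subsets of $\omega$ containing $\emptyset$ and closed under $S_0,S_1,\ldots\mapsto\{\langle\,\rangle\}\cup\bigcup_n\langle n\rangle\ast S_n$, with induction over stumps.) Let $q_0,q_1,\dots$ be a fixed enumeration of $\mathbb{Q}$ without repetitions. $\alpha$ is an enumeration of $A\subseteq\mathbb{Q}$ iff $\forall n[q_n\in A\leftrightarrow\exists m[\alpha(m)=n+1]]$. For $A,B\subseteq\mathbb{Q}$, $A<B$ iff $\forall q\in A\forall r\in B[q<r]$. $\mathcal{WO}$ (inductively well-ordered subsets of $\mathbb{Q}$)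 is the least collection of subsets of $\mathbb{Q}$ containing $\emptyset$ and every singleton $\{q\}$, and containing $\bigcup_nA_n$ whenever $A_0,A_1,\dots$ is a sequence of elements of $\mathcal{WO}$ with $A_n<A_{n+1}$ for all $n$. *)

(* Defs.v *)
From mathcomp Require Import all_boot all_order all_algebra.
Import Order.TTheory GRing.Theory Num.Theory.

Set Implicit Arguments.
Unset Strict Implicit.
Unset Printing Implicit Defensive.

Local Open Scope ring_scope.

(* Intuitionistic axioms, stated as propositions so that they can be assumed
   explicitly. Finite sequences of naturals are elements of [seq nat] rather
   than codes in nat: [mkseq g n] is the initial segment of g of length n,
   [rcons s n] is s * <n>, and [n :: t] is <n> * t. *)

Definition countable_choice : Prop :=
  forall (T : Type) (R : nat -> T -> Prop),
    (forall n, exists x, R n x) -> exists f : nat -> T, forall n, R n (f n).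

Definition bar (B : seq nat -> Prop) : Prop :=
  forall g : nat -> nat, exists n, B (mkseq g n).

(* Subsets are predicates, hence every clause of this and of the other
   inductive definition below is stated up to extensional equality. *)
Inductive stump : (seq nat -> Prop) -> Prop :=
| stump_empty S : (forall s, ~ S s) -> stump S
| stump_node S (T : nat -> seq nat -> Prop) :
    (forall n, stump (T n)) ->
    (forall s, S s <-> s = [::] \/ exists n t, s = n :: t /\ T n t) ->
    stump S.

Definition bar_theorem : Prop :=
  forall B, bar B -> exists S, stump S /\ bar (fun s => S s /\ B s).

Definition bar_induction : Prop :=
  forall B C : seq nat -> Prop,
    bar B -> (forall s, B s -> C s) ->
    (forall s, C s <-> forall n, C (rcons s n)) ->
    C [::].

Definition enumerates (q : nat -> rat) (alpha : nat -> nat)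
    (A : rat -> Prop) : Prop :=
  forall n, A (q n) <-> exists m, alpha m = n.+1.

Definition set_lt (A B : rat -> Prop) : Prop :=
  forall x y, A x -> B y -> x < y.

(* The condition A_0 < A_1 < A_2 < ... is read as a chain: A_m < A_n whenever
   m < n. As [set_lt] is vacuous when one side is empty, it is not transitive,
   and comparing only neighbours would not order the pieces of the union: see
   [WO_consecutive_enumerable] below. Empty pieces cannot be excluded either,
   since they are what makes finite ordered unions instances of the clause. *)
Inductive WO : (rat -> Prop) -> Prop :=
| WO_empty A : (forall x, ~ A x) -> WO A
| WO_single r A : (forall x, A x <-> x = r) -> WO A
| WO_union A (B : nat -> rat -> Prop) :
    (forall n, WO (B n)) ->
    (forall m n, (m < n)%N -> set_lt (B m) (B n)) ->
    (forall x, A x <-> exists n, B n x) ->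
    WO A.

(* The variant that compares neighbours only. It contains WO, but also every
   enumerable set of rationals. *)
Inductive WO_consecutive : (rat -> Prop) -> Prop :=
| WOc_empty A : (forall x, ~ A x) -> WO_consecutive A
| WOc_single r A : (forall x, A x <-> x = r) -> WO_consecutive A
| WOc_union A (B : nat -> rat -> Prop) :
    (forall n, WO_consecutive (B n)) ->
    (forall n, set_lt (B n) (B n.+1)) ->
    (forall x, A x <-> exists n, B n x) ->
    WO_consecutive A.

Lemma WO_sub_consecutive A : WO A -> WO_consecutive A.
Proof.
elim=> {A} [A A0|r A Ar|A B _ IH ltB AB].
- exact: WOc_empty.
- exact: WOc_single Ar.
- by apply: WOc_union IH _ AB => n; apply: ltB.
Qed.

Lemma WO_consecutive_enumerable q alpha A :
  (forall x, exists n, q n = x) -> enumerates q alpha A -> WO_consecutive A.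
Proof.
move=> q_onto enumA.
pose B n x : Prop :=
  [/\ ~~ odd n, (0 < alpha n./2)%N & x = q (alpha n./2).-1].
apply: (@WOc_union A B) => [n|n x y [nodd _ _] [/= + _ _]|x].
- have [cond|ncond] := boolP (~~ odd n && (0 < alpha n./2)%N).
    apply: (@WOc_single (q (alpha n./2).-1)) => x.
    by split=> [[]|->] //; case/andP: cond.
  by apply: WOc_empty => x [h1 h2 _]; rewrite h1 h2 in ncond.
- by rewrite nodd.
- have [k <-] := q_onto x; split=> [/enumA[m am]|[n [_ a_gt0 ->]]].
    by exists m.*2; rewrite /B odd_double doubleK am.
  by apply/enumA; exists n./2; rewrite prednK.
Qed.

(* Main.v *)
(** Call a finite sequence of indices descending if it lists, in strictly
decreasing order, elements of [A] given by [alpha].  The hypothesis says that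
the non-descending sequences form a bar, and bar induction is applied to
"if [s] is descending, then the set of elements of [A] below all entries of [s]
is in WO".  In the inductive step, let [U] be this set, and suppose that the
part of [U] below each of its elements is in WO.  The [n]-th enumerated element
[v n], if it lies in [U], contributes the piece of all [x <= v n] in [U] that
exceed the members of [U] enumerated before [n].  These pieces are in increasing
order, and each of them is a decidable part of [U] below [v n], followed by at
most the point [v n].  All case distinctions are decidable, so the argument is
intuitionistic. *)

Require Import Defs.
From mathcomp Require Import all_boot all_order all_algebra.
Import Order.TTheory GRing.Theory Num.Theory.

Local Open Scope ring_scope.

(** Restriction commutes with ordered unions, and as [p] is boolean it is decidable whether a
    singleton survives. With [predT] this gives invariance under extensional equality. *)
Lemma WO_restrict (A B : rat -> Prop) (p : pred rat) :
  WO A -> (forall x, B x <-> A x /\ p x) -> WO B.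
Proof.
move=> WA; elim: WA B => {A} [A A0|r A Ar|A F _ IH ltF AF] B AB.
- by apply: WO_empty => x /AB[/A0].
- have [pr|npr] := boolP (p r).
    apply: (@WO_single r) => x; split=> [/AB[/Ar]//|->].
    by apply/AB; split=> //; apply/Ar.
  by apply: WO_empty => x /AB[/Ar ->]; apply/negP.
- apply: (@WO_union _ (fun n x => F n x /\ p x)) => [n|m n mn x y [Fx _] [Fy _]|x].
  + by apply: (IH n).
  + exact: ltF mn _ _ Fx Fy.
  + split=> [/AB[/AF[n Fx] px]|[n [Fx px]]]; first by exists n.
    by apply/AB; split=> //; apply/AF; exists n.
Qed.

Lemma WO_union2 (A B C : rat -> Prop) :
  WO A -> WO B -> set_lt A B -> (forall x, C x <-> A x \/ B x) -> WO C.
Proof.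
move=> WA WB ltAB CE.
pose F n := match n with 0 => A | 1 => B | _ => fun=> False end.
apply: (@WO_union _ F) => [[|[|n]] //|[|[|m]] [|[|n]] // _ x y _ []|x].
- by apply: WO_empty => x.
- split=> [/CE[Ax|Bx]|[[|[|n]] // Fx]]; [by exists 0%N|by exists 1%N| |].
  + by apply/CE; left.
  + by apply/CE; right.
Qed.

Section Enumerated.

Variables (q : nat -> rat) (alpha : nat -> nat) (A : rat -> Prop).
Hypotheses (q_onto : forall x, exists n, q n = x)
           (enumA : enumerates q alpha A).

Let v m := q (alpha m).-1.
Let valid m := (0 < alpha m)%N.

Lemma enumerated_valid m : valid m -> A (v m).
Proof. by move=> am; apply/enumA; exists m; rewrite prednK. Qed.

Lemma enumerated_index x : A x -> exists2 m, valid m & x = v m.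
Proof.
have [k <-] := q_onto x; move=> /enumA[m am].
by exists m; rewrite /valid /v am.
Qed.

Lemma WO_of_initial_segments (b : pred rat) :
  (forall x y, x <= y -> b y -> b x) ->
  (forall m, valid m -> b (v m) -> WO (fun x => A x /\ x < v m)) ->
  WO (fun x => A x /\ b x).
Proof.
move=> b_down WOlt; pose D m := valid m && b (v m).
pose above n x := all (fun i => D i ==> (v i < x)) (iota 0 n).
pose E n x := A x /\ [&& D n, above n x & x <= v n].
apply: (@WO_union _ E) => [n|m n mn x y [_ /and3P[Dm _ xm]] [_ /and3P[_ yn _]]|x].
- have [Dn|nDn] := boolP (D n); last first.
    by apply: WO_empty => x [_ /and3P[Dn]]; rewrite Dn in nDn.
  have [valn bn] := andP Dn.
  apply: (@WO_union2 (fun x => (A x /\ x < v n) /\ above n x)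
                     (fun x => x = v n /\ above n x)) => [|||x].
  + exact: WO_restrict (WOlt n valn bn) (fun x => iff_refl _).
  + have Wv : WO (fun x => x = v n) by apply: (@WO_single (v n)).
    exact: WO_restrict Wv (fun x => iff_refl _).
  + by move=> x y [[_ xn] _] [-> _].
  + rewrite /E Dn /=; split=> [[Ax /andP[ab]]|[[[Ax xn] ->]|[-> ->]]].
    * by rewrite le_eqVlt => /orP[/eqP|]; [right|left].
    * by split=> //=; apply: ltW.
    * by split; [apply: enumerated_valid|rewrite lexx].
- have /(allP yn)/implyP/(_ Dm) : m \in iota 0 n by rewrite mem_iota.
  exact: le_lt_trans.
- split=> [[Ax bx]|[n [Ax /and3P[/andP[_ bn] _ xn]]]]; last first.
    by split=> //; apply: b_down xn bn.
  have exm : exists m, D m && (x <= v m).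
    have [m valm xm] := enumerated_index x Ax.
    by exists m; rewrite /D valm -xm bx lexx.
  (* The least index in [D] whose value is at least [x] names the piece of [x]: by minimality, all
     earlier values in [D] are less than [x]. *)
  case: (ex_minnP exm) => m /andP[Dm xm] m_min.
  exists m; split; rewrite // Dm xm andbT /=; apply/allP => i.
  rewrite mem_iota /= add0n => im; apply/implyP => Di.
  by rewrite ltNge; apply/negP => xi; have := m_min i; rewrite Di xi leqNgt im => /(_ isT).
Qed.

Definition descending s := all valid s && pairwise (fun m n => v n < v m) s.

Definition below s x := all (fun m => x < v m) s.

Lemma descending_rcons s n :
  descending (rcons s n) = [&& descending s, valid n & below s (v n)].
Proof.
rewrite /descending /below all_rcons pairwise_rcons andbACA.
exact: andbC.
Qed.

Lemma below_rcons s n x : below (rcons s n) x = (x < v n) && below s x.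
Proof. exact: all_rcons. Qed.

Lemma below_down s x y : x <= y -> below s y -> below s x.
Proof. by move=> xy; apply: sub_all => m; apply: le_lt_trans. Qed.

Lemma bar_not_descending :
  (forall gamma : nat -> nat, exists n,
     (forall i, (i <= n.+1)%N -> valid (gamma i)) ->
     v (gamma n) <= v (gamma n.+1)) ->
  bar (fun s => ~~ descending s).
Proof.
(* Length [n.+2] takes in [g 0] to [g n.+1], the entries that the hypothesis mentions. *)
move=> hA g; have [n gn] := hA g; exists n.+2; apply/negP.
case/andP=> /allP val_g /(pairwiseP 0%N) lt_g.
have: v (g n) <= v (g n.+1).
  by apply: gn => i ni; apply/val_g/mapP; exists i; rewrite ?mem_iota.
apply/negP; rewrite -ltNge.
have := lt_g n n.+1; rewrite !inE size_mkseq !nth_mkseq //.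
by apply.
Qed.

Lemma WO_of_bar (BI : bar_induction) :
  bar (fun s => ~~ descending s) -> WO A.
Proof.
move=> barB.
have: descending [::] -> WO (fun x => A x /\ below [::] x).
  (* The guard [descending s] makes the claim vacuous on the bar. *)
  apply: (BI _ (fun s => descending s -> WO (fun x => A x /\ below s x)) barB).
    by move=> s /negP.
  move=> s; split=> [Cs n|Cs ds].
    (* Lengthening [s] only adds the decidable condition [x < v n]. *)
    rewrite descending_rcons => /and3P[/Cs WOs _ _].
    apply: (@WO_restrict _ _ (fun x => x < v n) WOs) => x.
    by rewrite below_rcons; split=> [[Ax /andP[]]|[[Ax ->] ->]].
  (* A valid [m] with [v m] below [s] prolongs the descent, and then [x < v m] already implies
     [below s x], so the claim for [rcons s m] is about the whole initial segment of [A] at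
     [v m]. *)
  apply: WO_of_initial_segments => [|m valm bm]; first exact: below_down.
  have /Cs WOm : descending (rcons s m) by rewrite descending_rcons ds valm bm.
  apply: (@WO_restrict _ _ predT WOm) => x; rewrite below_rcons.
  split=> [[Ax xm]|[[Ax /andP[xm _]] _]] //.
  by split; rewrite // xm (below_down _ _ _ (ltW xm) bm).
move=> /(_ isT) WA.
by apply: (@WO_restrict _ _ predT WA) => x; split=> [|[[]]].
Qed.

End Enumerated.

Theorem theorem6p5
  (CC : countable_choice) (BT : bar_theorem) (BI : bar_induction)
  (q : nat -> rat) (q_inj : injective q) (q_onto : forall x, exists n, q n = x)
  (A : rat -> Prop) (alpha : nat -> nat) (enumA : enumerates q alpha A)
  (hA : forall gamma : nat -> nat, exists n : nat,
     (forall i : nat, (i <= n.+1)%N -> (0 < alpha (gamma i))%N) ->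
     q (alpha (gamma n)).-1 <= q (alpha (gamma n.+1)).-1) :
  WO A.
Proof.
exact: (WO_of_bar _ _ _ q_onto enumA BI (bar_not_descending _ _ hA)).
Qed.
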